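(* There is a universal constant $C$ such that for every Boolean function $f:\{0,1\}^n\to\{0,1\}$, $\deg(f)\le C\,\widetilde{\deg}(f)^2$.
   Context: $\deg(f)$ is the degree of the unique multilinear real polynomial agreeing with $f$ on $\{0,1\}^n$. A real polynomial $q$ $\epsilon$-approximates $f$ if $q(x)\in[0,\epsilon]$ for all $x\in f^{-1}(0)$ and $q(x)\in[1-\epsilon,1]$ for all $x\in f^{-1}(1)$. $\widetilde{\deg}(f)$ is the minimum degree of a polynomial that $1/3$-approximates $f$. *)

(* Defs.v *)
From mathcomp Require Import all_boot all_order all_algebra.
From mathcomp Require Import reals.
From mathcomp Require Import mpoly.
Set Implicit Arguments. Unset Strict Implicit. Unset Printing Implicit Defensive.
Import Order.TTheory GRing.Theory Num.Theory.
Local Open Scope ring_scope.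

Definition cube (n : nat) := {ffun 'I_n -> bool}.

Definition embed (R : realType) (n : nat) (x : cube n) : 'I_n -> R :=
  fun i => (x i)%:R.

(* Total degree of a real multivariate polynomial (0 for the zero poly). *)
Definition tdeg (R : realType) (n : nat) (p : {mpoly R[n]}) : nat :=
  (msize p).-1.

Definition multilinear (R : realType) (n : nat) (p : {mpoly R[n]}) : Prop :=
  forall m, m \in msupp p -> forall i : 'I_n, (m i <= 1)%N.

Definition represents (R : realType) (n : nat) (p : {mpoly R[n]})
  (f : cube n -> bool) : Prop :=
  forall x : cube n, p.@[embed R x] = (f x)%:R.

Definition eps_approx (R : realType) (n : nat) (eps : R) (q : {mpoly R[n]})
  (f : cube n -> bool) : Prop :=
  forall x : cube n,
    if f x then 1 - eps <= q.@[embed R x] <= 1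
    else 0 <= q.@[embed R x] <= eps.

(* Main.v *)
Require Import Defs.
From mathcomp Require Import all_boot all_order all_algebra.
From mathcomp Require Import reals.
From mathcomp Require Import mpoly.
From mathcomp Require Import zify ring lra.
Import Order.TTheory GRing.Theory Num.Theory.
Set Implicit Arguments.
Unset Strict Implicit.
Unset Printing Implicit Defensive.
Local Open Scope ring_scope.

(** Let m be a monomial of p, of support S, and let A be the adjacency operator
    of the cube in the directions of S.  Since the coefficient of m is nonzero,
    f agrees with the parity or with its negation on more than half of the
    subcube spanned by S.  By Huang's signed adjacency matrix there is a nonzero
    v supported on that part with |S|^(1/2) |v|^2 <= <|v|, A |v|>, and there all
    the edges counted by A are sensitive: q varies by at least 1/3 along them.
    Hence |S|^(1/2) |v|^2 / 3 <= <(-1)^f |v|, [A, q] |v|>, where q acts by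
    multiplication.  In the Fourier basis A is diagonal, with eigenvalue
    |S| - 2 (level) where the level of a character is the number of its variables
    in S, and multiplication by q only couples levels at distance at most
    k = deg q.  The commutator [A, q] is thus the matrix of q multiplied
    entrywise by twice a difference of levels.  On |s - t| <= k the kernel
    2 (t - s) is a difference of two tent functions, i.e. a sum over i of products
    (function of s, i) * (function of t, i), so this Schur multiplier has norm
    O(k).  Therefore |S|^(1/2) = O(k). *)

(** * Flips of a coordinate on the cube *)

Definition flip {n} (i : 'I_n) (x : cube n) : cube n :=
  [ffun j => x j (+) (j == i)].

Lemma flipE n (i j : 'I_n) (x : cube n) : flip i x j = x j (+) (j == i).
Proof. by rewrite ffunE. Qed.

Lemma flipK n (i : 'I_n) : involutive (@flip n i).
Proof. by move=> x; apply/ffunP => j; rewrite !flipE -addbA addbb addbF. Qed.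

Lemma flipC n (i j : 'I_n) (x : cube n) : flip i (flip j x) = flip j (flip i x).
Proof. by apply/ffunP => l; rewrite !flipE addbAC. Qed.

Lemma sum_flip (V : nmodType) n (i : 'I_n) (F : cube n -> V) :
  \sum_x F (flip i x) = \sum_x F x.
Proof.
by rewrite [RHS](reindex_inj (inv_inj (flipK i))).
Qed.

Lemma sum_flip_anti (R : numDomainType) n (i : 'I_n) (F : cube n -> R) :
  (forall x, F (flip i x) = - F x) -> \sum_x F x = 0.
Proof.
move=> FN; have E : \sum_x F x = - \sum_x F x.
  by rewrite -{1}(sum_flip i) -sumrN; apply: eq_bigr.
by apply/eqP; rewrite -eqNr -E.
Qed.

(** * Characters and the Fourier transform of the cube *)

Section Fourier.
Context {R : rcfType} {n : nat}.
Implicit Types (s t x y : cube n) (a b q : cube n -> R).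

Definition chi s x : R := \prod_i (-1) ^+ (s i && x i).

Lemma chiC s x : chi s x = chi x s.
Proof. by apply: eq_bigr => i _; rewrite andbC. Qed.

Lemma chi_flip s i x : chi s (flip i x) = (-1) ^+ s i * chi s x.
Proof.
rewrite /chi (bigD1 i) //= [in RHS](bigD1 i) //= flipE eqxx mulrA; congr (_ * _).
  by case: (s i); case: (x i); rewrite /= ?expr0 ?expr1 ?mulr1 ?mulN1r ?opprK.
by apply: eq_bigr => j /negPf ji; rewrite flipE ji addbF.
Qed.

Lemma chi_sqr s x : chi s x * chi s x = 1.
Proof.
by rewrite -big_split big1 //= => i _; rewrite -expr2 sqrr_sign.
Qed.

Local Notation N := (#|{: cube n}|%:R : R).

Lemma card_cube_gt0 : 0 < N.
Proof. by rewrite ltr0n; apply/card_gt0P; exists [ffun=> false]. Qed.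

Lemma chi_orth s t : \sum_x chi s x * chi t x = if s == t then N else 0.
Proof.
case: eqVneq => [->|/eqP st].
  rewrite (eq_bigr (fun=> 1)) => [|x _]; last exact: chi_sqr.
  by rewrite sumr_const.
have [i sti] : exists i, s i != t i.
  apply/existsP; apply: contraT; rewrite negb_exists => /forallP H.
  by case: st; apply/ffunP => i; apply/eqP; move: (H i); rewrite negbK.
apply: (@sum_flip_anti _ _ i) => x.
rewrite !chi_flip mulrACA -signr_addb.
have -> : s i (+) t i by case: (s i) (t i) sti => [] [].
by rewrite expr1 mulN1r.
Qed.

(** Left unnormalised: the cube also indexes its characters, so the transform is symmetric and
    squares to [N]. *)
Definition fourier a s : R := \sum_x chi s x * a x.

Lemma fourier_inv a x : fourier (fourier a) x = N * a x.
Proof.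
transitivity (\sum_y (\sum_s chi x s * chi y s) * a y).
  rewrite /fourier; under eq_bigr do rewrite big_distrr /=.
  rewrite exchange_big; apply: eq_bigr => y _; rewrite big_distrl /=.
  by apply: eq_bigr => s _; rewrite mulrA [chi s y]chiC.
rewrite (bigD1 x) //= chi_orth eqxx [X in _ + X]big1 ?addr0 // => y yx.
by rewrite chi_orth eq_sym (negPf yx) mul0r.
Qed.

Lemma fourier_pair a b :
  \sum_s fourier a s * fourier b s = N * \sum_x a x * b x.
Proof.
rewrite big_distrr /=.
transitivity (\sum_x a x * fourier (fourier b) x); last first.
  by apply: eq_bigr => x _; rewrite fourier_inv mulrCA.
rewrite /fourier.
under eq_bigr do rewrite big_distrl /=.
rewrite exchange_big; apply: eq_bigr => x _; rewrite big_distrr /=.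
by apply: eq_bigr => s _; rewrite chiC mulrCA -mulrA mulrCA.
Qed.

End Fourier.

(** * Levels and the commutator of adjacency with multiplication *)

Definition level {n} (S : {set 'I_n}) (x : cube n) : nat := \sum_(i in S) x i.

Lemma level_le n (S : {set 'I_n}) (x : cube n) : (level S x <= n)%N.
Proof.
rewrite -[leqRHS]card_ord; apply: leq_trans (max_card (mem S)).
by rewrite -sum1_card; apply: leq_sum => i _; apply: leq_b1.
Qed.

Lemma sum_interval (N l r : nat) :
  (\sum_(i < N) ((l <= i) && (i < r)) = minn r N - l)%N.
Proof.
elim: N => [|N IHN]; first by rewrite big_ord0 minn0.
by rewrite big_ord_recr IHN /=; case: (leqP l N) (ltnP N r) => ? [] ? /=; lia.
Qed.

Section Commutator.
Context {R : rcfType} {n : nat} (S : {set 'I_n}).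
Implicit Types (s t x y : cube n) (a b q : cube n -> R).

Local Notation N := (#|{: cube n}|%:R : R).
Local Notation lev := (level S).

Lemma sum_sign x :
  \sum_(i in S) (-1) ^+ x i = #|S|%:R - 2 * (lev x)%:R :> R.
Proof.
rewrite -sum1_card !natr_sum mulr_sumr -sumrB; apply: eq_bigr => i _.
by case: (x i) => /=; rewrite ?expr0 ?expr1; ring.
Qed.

Lemma fourier_flip i a s :
  fourier (fun x => a (flip i x)) s = (-1) ^+ s i * fourier a s.
Proof.
rewrite /fourier -(sum_flip i) mulr_sumr; apply: eq_bigr => x _.
by rewrite flipK chi_flip mulrA.
Qed.

(** A flip in direction [i] scales the coefficient at [t] by [(-1) ^+ t i]; over [S] these signs add
    up to [#|S| - 2 * lev t]. *)
Lemma fourier_level b x :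
  fourier (fun t => 2 * (lev t)%:R * fourier b t) x =
  N * (#|S|%:R * b x - \sum_(i in S) b (flip i x)).
Proof.
transitivity (#|S|%:R * fourier (fourier b) x -
    \sum_(i in S) fourier (fourier (fun y => b (flip i y))) x).
  under [X in _ - X]eq_bigr => i _.
    rewrite [fourier _ x]/fourier.
    under eq_bigr do rewrite fourier_flip.
    over.
  rewrite exchange_big [fourier _ x]/fourier [fourier (fourier b) x]/fourier.
  rewrite mulr_sumr -sumrB; apply: eq_bigr => t _.
  rewrite -mulr_sumr -mulr_suml sum_sign; ring.
rewrite fourier_inv mulrBr mulrCA mulr_sumr; congr (_ - _).
by apply: eq_bigr => i _; rewrite fourier_inv.
Qed.

(** Matrix of multiplication by [q] in the basis of characters, up to the factor [N]. *)
Definition mult_coef q s t : R := \sum_x chi s x * q x * chi t x.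

Lemma mult_coefE q (u v : cube n -> R) :
  \sum_s \sum_t u s * v t * mult_coef q s t =
  \sum_x q x * (fourier u x * fourier v x).
Proof.
rewrite /mult_coef; under eq_bigr => s _ do under eq_bigr => t _ do rewrite mulr_sumr.
under eq_bigr => s _ do rewrite exchange_big.
rewrite exchange_big; apply: eq_bigr => x _.
rewrite /fourier mulr_suml mulr_sumr; apply: eq_bigr => s _.
rewrite mulr_sumr mulr_sumr; apply: eq_bigr => t _.
rewrite (chiC x s) (chiC x t); ring.
Qed.

Lemma mult_coef_bound q (u v : cube n -> R) (M : R) :
  (forall x, `|q x| <= M) ->
  \sum_s \sum_t u s * v t * mult_coef q s t <=
  M / 2 * N * (\sum_s u s ^+ 2 + \sum_s v s ^+ 2).
Proof.
move=> qM; rewrite mult_coefE.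
have E (w : cube n -> R) : N * \sum_s w s ^+ 2 = \sum_x fourier w x ^+ 2.
  under [in RHS]eq_bigr do rewrite expr2.
  by rewrite fourier_pair; under [in RHS]eq_bigr do rewrite -expr2.
rewrite -mulrA mulrDr !E -big_split mulr_sumr /=; apply: ler_sum => x _.
have := qM x; rewrite ler_norml => /andP[q1 q2].
set c := fourier u x; set d := fourier v x.
(* The two products add up to [2 * M * (c ^+ 2 + d ^+ 2) - 4 * q x * c * d]. *)
have p1 : 0 <= (M - q x) * (c + d) ^+ 2 by rewrite mulr_ge0 ?sqr_ge0 ?subr_ge0.
have p2 : 0 <= (M + q x) * (c - d) ^+ 2 by rewrite mulr_ge0 ?sqr_ge0 //; lra.
lra.
Qed.

Lemma commutator_fourier q a b :
  N ^+ 2 * \sum_x \sum_(i in S) a x * b (flip i x) * (q (flip i x) - q x) =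
  \sum_s \sum_t 2 * ((lev t)%:R - (lev s)%:R) *
     (fourier a s * fourier b t * mult_coef q s t).
Proof.
transitivity (
  \sum_s \sum_t fourier a s * (2 * (lev t)%:R * fourier b t) * mult_coef q s t -
  \sum_s \sum_t (2 * (lev s)%:R * fourier a s) * fourier b t * mult_coef q s t);
  last first.
  rewrite -sumrB; apply: eq_bigr => s _; rewrite -sumrB; apply: eq_bigr => t _.
  ring.
rewrite !mult_coefE.
(* Adjacency is self-adjoint, so it moves from [q * b] onto [a]. *)
have E : \sum_x \sum_(i in S) a x * b (flip i x) * q (flip i x) =
         \sum_x \sum_(i in S) a (flip i x) * b x * q x.
  rewrite exchange_big [RHS]exchange_big; apply: eq_bigr => i _.
  by rewrite -[LHS](sum_flip i); apply: eq_bigr => x _; rewrite flipK.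
transitivity (N ^+ 2 * \sum_x \sum_(i in S)
    (a (flip i x) * b x * q x - a x * b (flip i x) * q x)).
  congr (_ * _).
  under [RHS]eq_bigr do rewrite sumrB; rewrite sumrB -E -sumrB.
  apply: eq_bigr => x _; rewrite -sumrB; apply: eq_bigr => i _; ring.
rewrite mulr_sumr -sumrB; apply: eq_bigr => x _.
rewrite !fourier_level !fourier_inv sumrB -!mulr_suml -mulr_sumr; ring.
Qed.

(** Windows of length [2 * k]: summing [wL * wR] over [i] gives the overlap of one window with two
    adjacent ones, a difference of two tents in [t - s]. *)
Let wL (k i s : nat) : R := ((s + k <= i) && (i < s + 3 * k))%N%:R.
Let wR (k i t : nat) : R := ((t <= i) && (i < t + 2 * k))%N%:R
                - ((t + 2 * k <= i) && (i < t + 4 * k))%N%:R.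

Lemma sum_intervalR (m l r : nat) :
  \sum_(i < m) ((l <= i) && (i < r))%N%:R = (minn r m - l)%N%:R :> R.
Proof. by rewrite -natr_sum sum_interval. Qed.

Lemma tent_identity (k s t : nat) :
  (s <= n)%N -> (t <= n)%N ->
  (s <= t + k)%N -> (t <= s + k)%N ->
  \sum_(i < n + 4 * k) wL k i s * wR k i t = 2 * (t%:R - s%:R).
Proof.
move=> sn tn st ts; rewrite /wL /wR.
(* Since [s] and [t] differ by at most [k], these are the two overlaps; the range [n + 4 * k] cuts
   off neither. *)
transitivity (\sum_(i < n + 4 * k) ((s + k <= i) && (i < t + 2 * k))%N%:R
   - \sum_(i < n + 4 * k) ((t + 2 * k <= i) && (i < s + 3 * k))%N%:R : R).
  rewrite -sumrB; apply: eq_bigr => i _; rewrite mulrBr -!natrM.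
  by congr (_%:R - _%:R); rewrite mulnb; congr nat_of_bool; lia.
rewrite !sum_intervalR.
have -> : (minn (t + 2 * k) (n + 4 * k) - (s + k) = t + k - s)%N by lia.
have -> : (minn (s + 3 * k) (n + 4 * k) - (t + 2 * k) = s + k - t)%N by lia.
by rewrite !natrB // !natrD; ring.
Qed.

Lemma sum_wL_sqr (k s : nat) : \sum_(i < n + 4 * k) wL k i s ^+ 2 <= (2 * k)%:R.
Proof.
rewrite /wL; under eq_bigr do rewrite -natrX -mulnn mulnb andbb.
by rewrite sum_intervalR ler_nat; lia.
Qed.

Lemma sum_wR_sqr (k t : nat) : \sum_(i < n + 4 * k) wR k i t ^+ 2 <= (4 * k)%:R.
Proof.
rewrite /wR (eq_bigr (fun i : 'I__ => ((t <= i) && (i < t + 4 * k))%N%:R)).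
  by rewrite sum_intervalR ler_nat; lia.
move=> i _.
case: (leqP t i) => ?; case: (ltnP i (t + 2 * k)) => ?;
  case: (leqP (t + 2 * k) i) => ?; case: (ltnP i (t + 4 * k)) => ? /=;
  try lia; ring.
Qed.

(** The tent identity splits the level difference into products of weights in [s] and in [t]. Each
    [i] is then a plain quadratic form of [q], and the squared weights sum to at most [2 * k] and
    [4 * k]. *)
Lemma commutator_bound (k : nat) (M : R) q a b :
  (forall x, `|q x| <= M) ->
  (forall s t, ~~ ((lev s <= lev t + k) && (lev t <= lev s + k))%N ->
     mult_coef q s t = 0) ->
  \sum_x \sum_(i in S) a x * b (flip i x) * (q (flip i x) - q x) <=
  M * k%:R * (\sum_x a x ^+ 2 + 2 * \sum_x b x ^+ 2).
Proof.
move=> qM q0.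
have N0 : 0 < N :> R by apply: card_cube_gt0.
have M0 : 0 <= M by apply: le_trans (normr_ge0 _) (qM [ffun=> false]).
rewrite -(ler_pM2l (exprn_gt0 2 N0)) commutator_fourier.
have -> : \sum_s \sum_t 2 * ((lev t)%:R - (lev s)%:R) *
     (fourier a s * fourier b t * mult_coef q s t) =
  \sum_(i < n + 4 * k) \sum_s \sum_t
    (wL k i (lev s) * fourier a s) * (wR k i (lev t) * fourier b t) *
    mult_coef q s t.
  rewrite [RHS]exchange_big; apply: eq_bigr => s _.
  rewrite [RHS]exchange_big; apply: eq_bigr => t _.
  (* Outside the band, where the tent identity may fail, the coefficient of [q] is zero. *)
  have [/andP[st ts]|/q0 ->] :=
    boolP ((lev s <= lev t + k) && (lev t <= lev s + k))%N; last first.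
    by rewrite !mulr0 big1 // => i _; rewrite mulr0.
  rewrite -(@tent_identity k) ?level_le // mulr_suml; apply: eq_bigr => i _.
  ring.
apply: (@le_trans _ _ (\sum_(i < n + 4 * k) M / 2 * N *
   (\sum_s (wL k i (lev s) * fourier a s) ^+ 2 +
    \sum_s (wR k i (lev s) * fourier b s) ^+ 2))).
  by apply: ler_sum => i _; apply: mult_coef_bound.
have P (c : cube n -> R) : \sum_s fourier c s ^+ 2 = N * \sum_x c x ^+ 2.
  under eq_bigr do rewrite expr2.
  by rewrite fourier_pair; under eq_bigr do rewrite -expr2.
have Q (w : nat -> nat -> R) (c : cube n -> R) (K : nat) :
    (forall s : nat, \sum_(i < n + 4 * k) w i s ^+ 2 <= K%:R) ->
    \sum_(i < n + 4 * k) \sum_s (w i (lev s) * fourier c s) ^+ 2 <=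
    K%:R * (N * \sum_x c x ^+ 2).
  move=> wK; rewrite exchange_big -P mulr_sumr; apply: ler_sum => s _.
  under eq_bigr do rewrite exprMn.
  by rewrite -mulr_suml ler_wpM2r ?sqr_ge0.
rewrite -mulr_sumr big_split.
have := Q (wL k) a _ (@sum_wL_sqr k); have := Q (wR k) b _ (@sum_wR_sqr k).
rewrite !natrM; set A1 := \sum_(i < _) _; set A2 := \sum_(i < _) _ => h2 h1.
apply: (@le_trans _ _ (M / 2 * N * (2%:R * k%:R * (N * \sum_x a x ^+ 2) +
   4%:R * k%:R * (N * \sum_x b x ^+ 2)))).
  by rewrite ler_wpM2l ?lerD // mulr_ge0 ?divr_ge0 // ltW.
lra.
Qed.

End Commutator.

(** * Huang's signed adjacency operator and its eigenvectors *)

Lemma homogeneous_solution (R : fieldType) (T E : finType) (L : E -> T -> R) :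
  (#|E| < #|T|)%N ->
  exists2 g : T -> R, (exists t, g t != 0) & forall e, \sum_t L e t * g t = 0.
Proof.
move=> ET.
pose M : 'M[R]_(#|T|, #|E|) := \matrix_(i, j) L (enum_val j) (enum_val i).
have : kermx M != 0.
  rewrite -mxrank_eq0 mxrank_ker subn_eq0 -ltnNge.
  exact: leq_ltn_trans (rank_leq_col M) ET.
case/rowV0Pn => v /sub_kermxP vM /rV0Pn[i vi].
exists (fun t => v 0 (enum_rank t)); first by exists (enum_val i); rewrite enum_valK.
move=> e; have /matrixP/(_ 0 (enum_rank e)) := vM; rewrite !mxE => eM.
rewrite -[RHS]eM [RHS](reindex enum_rank) /=; last by apply: onW_bij; exact: enum_rank_bij.
by apply: eq_bigr => t _; rewrite !mxE !enum_rankK mulrC.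
Qed.

Section Huang.
Context {R : rcfType} {n : nat} (S : {set 'I_n}).
Implicit Types (x y : cube n) (v g : cube n -> R).

Definition parity x : bool := odd (\sum_i x i).

Lemma parity_flip i x : parity (flip i x) = ~~ parity x.
Proof.
rewrite /parity (bigD1 i) //= [in RHS](bigD1 i) //= !oddD flipE eqxx.
rewrite (eq_bigr (fun j => x j : nat)) => [|j /negPf ji]; last first.
  by rewrite flipE ji addbF.
by case: (x i) => /=; rewrite ?addTb ?addFb ?negbK.
Qed.

Definition subcube : {set cube n} := [set x : cube n | [forall i, x i ==> (i \in S)]].

Lemma subcube_flip i x : i \in S -> (flip i x \in subcube) = (x \in subcube).
Proof.
move=> iS; rewrite !inE; apply: eq_forallb => j; rewrite flipE.
by have [->|] := eqVneq j i; rewrite ?iS ?implybT ?addbF.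
Qed.

(* These signs make the flips in distinct directions anticommute. *)
Definition huang_sign (i : 'I_n) x : R :=
  \prod_(j : 'I_n | (j < i)%N) (-1) ^+ x j.

Lemma huang_sign_flip i j x :
  huang_sign i (flip j x) = (-1) ^+ (j < i)%N * huang_sign i x.
Proof.
rewrite /huang_sign; case: (ltnP j i) => ji.
  rewrite (bigD1 j) //= [in RHS](bigD1 j) //= flipE eqxx mulrA; congr (_ * _).
    by case: (x j); rewrite ?expr0 ?expr1 ?mulr1 ?mulN1r ?opprK.
  by apply: eq_bigr => l /andP[_ /negPf lj]; rewrite flipE lj addbF.
rewrite mul1r; apply: eq_bigr => l li; rewrite flipE.
have /negPf -> : l != j by apply: contraTneq li => ->; rewrite -leqNgt.
by rewrite addbF.
Qed.

Lemma huang_sign_sqr i x : huang_sign i x * huang_sign i x = 1.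
Proof.
by rewrite -big_split big1 //= => j _; rewrite -expr2 sqrr_sign.
Qed.

Lemma norm_huang_sign i x : `|huang_sign i x| = 1.
Proof.
by rewrite normr_prod big1 // => j _; rewrite normr_sign.
Qed.

Definition huang v x : R := \sum_(i in S) huang_sign i x * v (flip i x).

Lemma huangD v g (c : R) x :
  huang (fun y => v y + c * g y) x = huang v x + c * huang g x.
Proof.
rewrite /huang mulr_sumr -big_split; apply: eq_bigr => i _ /=; ring.
Qed.

(** The signed flips are anticommuting involutions: cross terms cancel and each direction of [S]
    contributes [v x]. *)
Lemma huangK v x : huang (huang v) x = #|S|%:R * v x.
Proof.
pose F i j := huang_sign i x * (huang_sign j (flip i x) * v (flip j (flip i x))).
have E : huang (huang v) x = \sum_(i in S) \sum_(j in S) F i j.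
  by apply: eq_bigr => i _; rewrite mulr_sumr.
have FN i j : i != j -> F i j = - F j i.
  move=> ij; rewrite /F !huang_sign_flip [flip j (flip i x)]flipC.
  by case: (ltngtP i j) (ij) => [||/val_inj ->]; rewrite ?eqxx //= => _ _; ring.
have Fd i : F i i = v x.
  by rewrite /F huang_sign_flip ltnn mul1r flipK mulrA huang_sign_sqr mul1r.
have D : \sum_(i in S) \sum_(j in S) (F i j + F j i) =
         \sum_(i in S) \sum_(j in S) (if i == j then 2 * v x else 0).
  apply: eq_bigr => i _; apply: eq_bigr => j _.
  case: eqVneq => [->|/FN ->]; first by rewrite Fd; ring.
  by rewrite addNr.
have : 2 * huang (huang v) x = 2 * (#|S|%:R * v x).
  transitivity (\sum_(i in S) \sum_(j in S) (F i j + F j i)).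
    under eq_bigr do rewrite big_split /=.
    by rewrite big_split /= [X in _ + X]exchange_big -E; ring.
  rewrite D; transitivity (\sum_(i in S) 2 * v x).
    apply: eq_bigr => i iS; rewrite (bigD1 i) //= eqxx big1 ?addr0 // => j.
    by case/andP=> _; rewrite eq_sym => /negPf ->.
  by rewrite sumr_const -mulr_natl; ring.
by move/mulfI; apply; rewrite pnatr_eq0.
Qed.

(** Dimension count: the values on even points of the subcube are free unknowns, and vanishing on
    [W] inside the subcube imposes fewer linear conditions. *)
Lemma huang_eigenvector (W : {set cube n}) :
  (0 < #|S|)%N ->
  (#|[set x in subcube | x \in W]| < #|[set x in subcube | ~~ parity x]|)%N ->
  exists v, [/\ exists x, v x != 0,
     forall x, v x != 0 -> (x \in subcube) && (x \notin W) &
     forall x, huang v x = Num.sqrt #|S|%:R * v x].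
Proof.
set d : R := #|S|%:R; set A := [set x in _ | _]; set Ev := [set x in _ | ~~ _].
move=> S0 AE; have d0 : 0 < d by rewrite ltr0n.
have r0 : Num.sqrt d != 0 by rewrite sqrtr_eq0 -ltNge.
have rr : Num.sqrt d * Num.sqrt d = d by rewrite -expr2 sqr_sqrtr // ltW.
(* Since [huang] squares to [d], [ext h] is an eigenvector for every [h]; if [h]
   is supported on the even points, so that [huang h] lives on the odd ones,
   [ext h] does not vanish unless [h] does. *)
pose ext (h : cube n -> R) x := h x + (Num.sqrt d)^-1 * huang h x.
have EvP x : x \in Ev = (x \in subcube) && ~~ parity x by rewrite inE.
pose L (e : {x | x \in A}) (t : {x | x \in Ev}) : R :=
  ext (fun y => (y == val t)%:R) (val e).
have [|g [t gt] gL] := @homogeneous_solution R _ _ L.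
  by rewrite !card_sig.
pose h x : R := \sum_t g t * (x == val t)%:R.
have hE x : x \notin Ev -> h x = 0.
  move=> xE; rewrite /h big1 // => u _; case: eqP xE => [->|]; last by rewrite mulr0.
  by rewrite (valP u).
have ht : h (val t) = g t.
  rewrite /h (bigD1 t) //= eqxx mulr1 big1 ?addr0 // => u /negPf ut.
  by rewrite (inj_eq val_inj) eq_sym ut mulr0.
have huang_h x : huang h x = \sum_t g t * huang (fun y => (y == val t)%:R) x.
  rewrite /huang /h; under [RHS]eq_bigr do rewrite mulr_sumr.
  rewrite [RHS]exchange_big; apply: eq_bigr => i _; rewrite mulr_sumr.
  by apply: eq_bigr => u _; rewrite mulrCA.
have huang0 x : ~~ ((x \in subcube) && parity x) -> huang h x = 0.
  move=> xP; rewrite /huang big1 // => i iS; rewrite hE ?mulr0 //.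
  by rewrite EvP subcube_flip // parity_flip negbK.
exists (ext h); split.
- exists (val t); rewrite /ext ht huang0 ?mulr0 ?addr0 //.
  by have := valP t; rewrite EvP => /andP[_ /negPf ->]; rewrite andbF.
- move=> x; apply: contraR => xN; apply/eqP.
  have [xS|xS] := boolP (x \in subcube); last first.
    by rewrite /ext hE ?EvP ?(negPf xS) // huang0 ?(negPf xS) // mulr0 addr0.
  have xA : x \in A by rewrite inE xS; move: xN; rewrite xS negbK.
  rewrite -[RHS](gL (exist _ x xA)) /L /ext huang_h mulr_sumr -big_split.
  by apply: eq_bigr => u _ /=; ring.
move=> x; rewrite /ext mulrDr mulrA mulfV // mul1r.
rewrite huangD huangK -/d -[X in _^-1 * (X * _)]rr; by field.
Qed.

End Huang.

(** * Low degree and the band structure of [mult_coef] *)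

Section Polynomials.
Context {R : realType} {n : nat}.
Implicit Types (x s t : cube n) (m : 'X_{1..n}) (p q : {mpoly R[n]}).

Definition monom_at m x : R := \prod_i embed R x i ^+ m i.

Lemma monom_at_flip m i x : m i = 0%N -> monom_at m (flip i x) = monom_at m x.
Proof.
move=> mi; apply: eq_bigr => j _; rewrite /embed flipE.
by case: eqVneq => [->|]; rewrite ?mi ?expr0 ?addbF.
Qed.

Lemma monom_at_eq0 m i x : m i != 0%N -> ~~ x i -> monom_at m x = 0.
Proof.
move=> mi /negPf xi; rewrite /monom_at (bigD1 i) //= /embed xi expr0n.
by rewrite (negPf mi) mul0r.
Qed.

(** If [s] and [t] differed only at variables of [m], each difference would use up a unit of the
    degree of [m]. *)
Lemma level_gap (S : {set 'I_n}) m s t :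
  (level S t + mdeg m < level S s)%N -> exists2 i, s i != t i & m i = 0%N.
Proof.
move=> gap.
have : [exists i, (s i != t i) && (m i == 0%N)].
  apply: contraLR gap; rewrite negb_exists -leqNgt => /forallP H.
  rewrite /level mdegE.
  apply: (@leq_trans (\sum_(i in S) t i + \sum_(i in S) m i)); last first.
    by rewrite leq_add2l [leqRHS](bigID (mem S)) /= leq_addr.
  rewrite -big_split; apply: leq_sum => i _ /=.
  by have := H i; case: (s i); case: (t i); case: (m i).
by case/existsP=> i /andP[sti /eqP mi]; exists i.
Qed.

Lemma mult_coef_low_degree (S : {set 'I_n}) q (c : R) s t :
  ~~ ((level S s <= level S t + tdeg q) && (level S t <= level S s + tdeg q))%N ->
  mult_coef (fun x => q.@[embed R x] - c) s t = 0.
Proof.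
move=> gap.
have mgap m : (mdeg m <= tdeg q)%N -> exists2 i, s i != t i & m i = 0%N.
  move=> mq; move: gap; rewrite negb_and -!ltnNge => /orP[gap|gap].
    by apply: (@level_gap S); lia.
  have [|i ts mi] := @level_gap S m t s; first by lia.
  by exists i; rewrite // eq_sym.
(* Flipping a variable absent from [m] where [s] and [t] differ negates the summand. *)
have mzero m : (mdeg m <= tdeg q)%N ->
    \sum_x chi s x * monom_at m x * chi t x = 0.
  case/mgap=> i st mi; apply: (@sum_flip_anti _ _ i) => x.
  rewrite monom_at_flip // !chi_flip.
  by case: (s i) (t i) st => [] [] // _; rewrite !(expr0, expr1); ring.
rewrite /mult_coef.
transitivity (\sum_(m <- msupp q) q@_m * (\sum_x chi s x * monom_at m x * chi t x)
   - c * \sum_x chi s x * monom_at 0%MM x * chi t x).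
  under [X in _ = X - _]eq_bigr do rewrite mulr_sumr.
  rewrite [X in _ = X - _]exchange_big mulr_sumr -sumrB; apply: eq_bigr => x _.
  rewrite mevalE mulrBr mulrBl mulr_sumr mulr_suml; congr (_ - _).
    by apply: eq_bigr => m _; rewrite /monom_at; ring.
  rewrite /monom_at big1 => [|i _]; last by rewrite mnmE expr0.
  ring.
rewrite mzero ?mdeg0 // mulr0 subr0 big_seq big1 // => m mq.
by rewrite mzero ?mulr0 // /tdeg; have := msize_mdeg_lt mq; lia.
Qed.

(** * Correlation with parity on the subcube of a monomial *)

Definition psign x : R := (-1) ^+ parity x.

Lemma psign_flip i x : psign (flip i x) = - psign x.
Proof. by rewrite /psign parity_flip signrN. Qed.

(** Only [m] survives: a monomial missing a variable of [S] cancels under its flip, one with a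
    variable outside [S] vanishes on the subcube. The monomial [m] is itself nonzero only at the
    indicator of [S]. *)
Lemma top_coefficient p m (S := [set i | m i != 0%N]) :
  multilinear p -> m \in msupp p ->
  \sum_(x in subcube S) psign x * p.@[embed R x] != 0.
Proof.
move=> pml mp.
have anti m' i : i \in S -> m' i = 0%N ->
    \sum_(x in subcube S) psign x * monom_at m' x = 0.
  move=> iS m'i; rewrite big_mkcond; apply: (@sum_flip_anti _ _ i) => x.
  by rewrite subcube_flip // psign_flip monom_at_flip //; case: ifP; rewrite ?oppr0 ?mulNr.
pose o : cube n := [ffun i => i \in S].
have oS : o \in subcube S by rewrite inE; apply/forallP => i; rewrite ffunE implybb.
have sumE : \sum_(x in subcube S) psign x * p.@[embed R x] =
    \sum_(m' <- msupp p) p@_m' * \sum_(x in subcube S) psign x * monom_at m' x.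
  under [RHS]eq_bigr do rewrite mulr_sumr.
  rewrite [RHS]exchange_big; apply: eq_bigr => x _.
  by rewrite mevalE mulr_sumr; apply: eq_bigr => m' _; rewrite mulrCA.
rewrite sumE (bigD1_seq m) //= ?msupp_uniq // [X in _ + X]big1_seq ?addr0; last first.
  move=> m' /andP[m'm m'p].
  have [i mi] : exists i, m' i != m i.
    apply/existsP; apply: contraR m'm; rewrite negb_exists => /forallP H.
    by apply/eqP/mnmP => i; apply/eqP; move: (H i); rewrite negbK.
  have [iS|iS] := boolP (i \in S).
    rewrite (anti _ i) ?mulr0 //.
    by have := pml _ m'p i; have := pml _ mp i; move: iS mi; rewrite inE; lia.
  rewrite big1 ?mulr0 // => x; rewrite inE => /forallP xS.
  rewrite (@monom_at_eq0 _ i) ?mulr0 //.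
    by move: iS mi; rewrite inE negbK => /eqP ->.
  by apply: contra iS => xi; have := xS i; rewrite xi.
rewrite mulf_neq0 ?mcoeff_neq0 -?mcoeff_msupp //.
rewrite (bigD1 o) //= [X in _ + X]big1 ?addr0 => [|x /andP[xS xo]].
  rewrite mulf_neq0 // ?signr_eq0 //; apply/prodf_neq0 => i _.
  by rewrite /embed ffunE inE; case: (m i) => [|j]; rewrite ?expr0 ?expr1n oner_neq0.
have [i xi] : exists i, x i != o i.
  apply/existsP; apply: contraR xo; rewrite negb_exists => /forallP H.
  by apply/eqP/ffunP => i; apply/eqP; move: (H i); rewrite negbK.
move: xi; rewrite ffunE => xi; move: xS; rewrite inE => /forallP/(_ i) xS.
rewrite (@monom_at_eq0 _ i) ?mulr0 //.
  by move: xi xS; case: (x i); rewrite ?inE //=; case: (m i).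
by move: xi xS; case: (x i); case: (i \in S).
Qed.

Lemma card_setIdE (T : finType) (A : {set T}) (P : pred T) :
  #|[set z in A | P z]|%:R = \sum_(z in A) (P z)%:R :> R.
Proof.
rewrite -natr_sum -sum1_card; congr _%:R.
rewrite (eq_bigl (fun z => (z \in A) && P z)) => [|z]; last by rewrite inE.
by rewrite big_mkcondr; apply: eq_bigr => z _; case: (P z).
Qed.

Lemma unbalanced_half (S : {set 'I_n}) (f : cube n -> bool) :
  (0 < #|S|)%N -> \sum_(x in subcube S) psign x * (f x)%:R != 0 ->
  exists b, (#|[set x in subcube S | x \in [set y | f y (+) parity y == b]]| <
             #|[set x in subcube S | ~~ parity x]|)%N.
Proof.
case/card_gt0P=> i iS; set Z := \sum_(x in _) _ => Z0.
have P0 : \sum_(x in subcube S) psign x = 0.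
  rewrite big_mkcond; apply: (@sum_flip_anti _ _ i) => x.
  by rewrite subcube_flip // psign_flip; case: ifP; rewrite ?oppr0.
pose c b : R := \sum_(x in subcube S) (f x (+) parity x == b)%:R.
pose e : R := \sum_(x in subcube S) (~~ parity x)%:R.
have cT : c true = e + Z.
  rewrite -[RHS]subr0 -P0 -big_split -sumrB; apply: eq_bigr => x _ /=.
  by rewrite /psign; case: (f x); case: (parity x); rewrite /= ?expr0 ?expr1; ring.
have cF : c false = e - Z.
  rewrite -sumrB; apply: eq_bigr => x _ /=.
  by rewrite /psign; case: (f x); case: (parity x); rewrite /= ?expr0 ?expr1; ring.
have cE b : #|[set x in subcube S | x \in [set y | f y (+) parity y == b]]|%:R = c b.
  by rewrite card_setIdE; apply: eq_bigr => x _; rewrite inE.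
(* The two classes have sizes [e + Z] and [e - Z]; the sign of [Z] selects the smaller. *)
exists (Z < 0); rewrite -(ltr_nat R) cE card_setIdE -/e.
by have [Zn|Zp] := ltP Z 0; [rewrite cT; lra|rewrite cF; lra].
Qed.

Lemma degree_bound (f : cube n -> bool) p q m :
  multilinear p -> represents p f -> eps_approx 3%:R^-1 q f ->
  m \in msupp p -> (mdeg m <= 21 * tdeg q ^ 2)%N.
Proof.
move=> pml pf qf mp; set k := tdeg q; pose S := [set i | m i != 0%N].
have dE : mdeg m = #|S|.
  rewrite mdegE -sum1_card big_mkcond [RHS]big_mkcond; apply: eq_bigr => i _ /=.
  by rewrite inE; have := pml _ mp i; case: (m i) => [|[|]].
have [S0|S0] := posnP #|S|; first by rewrite dE S0.
have := top_coefficient pml mp; rewrite -/S.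
under eq_bigr do rewrite pf.
case/(unbalanced_half S0) => b /(huang_eigenvector (R := R) S0).
case=> v [[y vy] vW vH].
pose u x := `|v x|.
(* Centring halves the sup bound and leaves differences along edges unchanged. *)
pose Q x := q.@[embed R x] - 2^-1.
have Qb x : `|Q x| <= 2^-1.
  rewrite /Q ler_norml; have := qf x; case: (f x) => /andP[]; lra.
have uE : \sum_x u x ^+ 2 = \sum_x v x ^+ 2.
  by apply: eq_bigr => x _; rewrite /u real_normK ?num_real.
have aE : \sum_x ((-1) ^+ f x * u x) ^+ 2 = \sum_x v x ^+ 2.
  by rewrite -uE; apply: eq_bigr => x _; rewrite exprMn sqrr_sign mul1r.
have := @commutator_bound R n S k 2^-1 Q (fun x => (-1) ^+ f x * u x) u Qb
  (fun s t => @mult_coef_low_degree S q 2^-1 s t).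
rewrite aE uE; set X := \sum_x v x ^+ 2 => up.
have X0 : 0 < X.
  rewrite /X (bigD1 y) //= ltr_wpDr ?exprn_even_gt0 //.
  by apply: sumr_ge0 => x _; apply: sqr_ge0.
have lo : 3^-1 * (Num.sqrt #|S|%:R * X) <=
    \sum_x \sum_(i in S) (-1) ^+ f x * u x * u (flip i x) * (Q (flip i x) - Q x).
  rewrite /X !mulr_sumr; apply: ler_sum => x _.
  rewrite expr2 [_ * (v x * v x)]mulrA -vH /huang mulr_suml mulr_sumr.
  apply: ler_sum => i iS.
  have [vx|vx] := eqVneq (v x) 0; first by rewrite /u vx normr0 !(mulr0, mul0r).
  have [vf|vf] := eqVneq (v (flip i x)) 0.
    by rewrite /u vf normr0 !(mulr0, mul0r).
  (* Both ends lie in the support of [v], where [f (+) parity] is constant, while the flip changes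
     the parity. *)
  have fE : f (flip i x) = ~~ f x.
    have := vW _ vx; have := vW _ vf; rewrite !inE parity_flip.
    case/andP=> _ + /andP[_].
    by case: (f x); case: (f _); case: (parity x); case: (b).
  have D : 3^-1 <= (-1) ^+ f x * (Q (flip i x) - Q x).
    have := qf x; have := qf (flip i x); rewrite /Q fE.
    by case: (f x) => /= /andP[? ?] /andP[? ?]; rewrite ?expr0 ?expr1; lra.
  have h : huang_sign i x * v (flip i x) * v x <= u x * u (flip i x).
    apply: le_trans (ler_norm _) _.
    by rewrite !normrM norm_huang_sign mul1r mulrC.
  have u0 : 0 <= u x * u (flip i x) by rewrite mulr_ge0 ?normr_ge0.
  apply: (@le_trans _ _ (3^-1 * (u x * u (flip i x)))).
    by rewrite ler_wpM2l ?invr_ge0 ?ler0n.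
  have -> : (-1) ^+ f x * u x * u (flip i x) * (Q (flip i x) - Q x) =
    ((-1) ^+ f x * (Q (flip i x) - Q x)) * (u x * u (flip i x)) by ring.
  by rewrite ler_wpM2r.
have {lo up} : 3^-1 * Num.sqrt #|S|%:R * X <= 3 / 2 * k%:R * X.
  by rewrite -mulrA; apply: le_trans lo _; apply: le_trans up _; lra.
rewrite ler_pM2r // => sk.
have r0 := sqrtr_ge0 (#|S|%:R : R).
have rr : Num.sqrt #|S|%:R ^+ 2 = #|S|%:R :> R by rewrite sqr_sqrtr.
rewrite dE -(ler_nat R) natrM natrX -rr.
(* Squaring gives the factor [81 / 4], which is below [21]. *)
have : Num.sqrt #|S|%:R ^+ 2 <= (9 / 2 * k%:R) ^+ 2 :> R.
  by rewrite lerXn2r ?nnegrE //; [rewrite mulr_ge0 // ; lra|lra].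
by rewrite exprMn; have := sqr_ge0 (k%:R : R); lra.
Qed.

End Polynomials.

(* deg(f) <= C * adeg(f)^2, where deg(f) is the degree of the (unique)
   multilinear polynomial p representing f, and adeg(f) is the minimum
   degree of a 1/3-approximating polynomial q: equivalently, the bound
   holds against the degree of every 1/3-approximating q. *)
Theorem theorem1p4 :
  exists C : nat,
  forall (R : realType) (n : nat) (f : cube n -> bool) (p q : {mpoly R[n]}),
    multilinear p -> represents p f ->
    eps_approx (3%:R)^-1 q f ->
    (tdeg p <= C * (tdeg q) ^ 2)%N.
Proof.
exists 21%N => R n f p q pml pf qf.
suff : (msize p <= (21 * tdeg q ^ 2).+1)%N by rewrite /tdeg; lia.
rewrite msizeE; apply/bigmax_leqP_seq => m mp _.
exact: degree_bound pml pf qf mp.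
Qed.
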